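(* Let $N\ge 1$ and $0\le n\le N$ be integers, let $\mathcal X_{N,n}:=\{x\in\{TM,MT\}^N:\sum_{j=1}^N 1\{x_j=TM\}=n\}$, and let $\overline h:=\log(|\mathcal X_{N,n}|)$. Fix $y\in\mathcal X_{N,n}$ (the realized value of $Y_N$). For every $h\in(0,\overline h]$, consider the problem of minimizing, over all probability distributions $P$ on $\mathcal X_{N,n}$ (the conditional distribution of $X_N$ given $Y_N=y$), $$\min_{P}\ \mathbb E_{X\sim P}[\ell(X,y)]\quad\text{subject to}\quad H(P)\ge h .$$ Then for every $h\in(0,\overline h]$ this problem has exactly one interior solution, denoted $P^*_y(h)$, and: \begin{enumerate} \item $H(P^*_y(h))=h$ for every $h\in(0,\overline h]$; \item if $\overline h>0$, then $\lim_{h\to0^+}\sup_{x\in\mathcal X_{N,n}}\left|P^*_y(h)(x)-\delta_{y}(x)\right|=0$; \item if $\overline h>0$, then $P^*_y(\overline h)$ is the uniform distribution on $\mathcal X_{N,n}$; \item for all $h,h'\in(0,\overline h]$ with $h\le h'$, the random variable $\ell(X,y)$ with $X\sim P^*_y(h')$ first-order stochastically dominates the random variable $\ell(X,y)$ with $X\sim P^*_y(h)$. \end{enumerate}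
   Context: $TM$ and $MT$ are two distinct labels. The misclassification loss is $\ell(x,y):=\sum_{j=1}^N 1\{x_j\ne y_j\}$ for $x,y\in\mathcal X_{N,n}$. For a probability distribution $P$ on a finite set $\mathcal X$, the Shannon entropy is $H(P):=-\sum_{x\in\mathcal X}P(x)\log(P(x))$, with the convention $0\log 0=0$ and $\log$ the natural logarithm. $\delta_y$ is the Dirac distribution at $y$, so $\delta_y(x)=1$ if $x=y$ and $0$ otherwise. A solution of the minimization problem is a feasible $P$ attaining the minimum; it is interior if $P(x)>0$ for every $x\in\mathcal X_{N,n}$. A real random variable $Z'$ first-order stochastically dominates a real random variable $Z$ if $\Pr(Z'\le t)\le \Pr(Z\le t)$ for every $t\in\mathbb R$ (equivalently, $\mathbb E[u(Z')]\ge\mathbb E[u(Z)]$ for every non-decreasing $u$, for finitely valued variables). *)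

(* Defs.v *)
From HB Require Import structures.
From mathcomp Require Import all_boot all_order all_algebra.
From mathcomp Require Import all_classical all_reals all_analysis.
Set Implicit Arguments.
Unset Strict Implicit.
Unset Printing Implicit Defensive.
Import Order.TTheory GRing.Theory Num.Theory.
Import numFieldNormedType.Exports.
Local Open Scope ring_scope.

Inductive label := TM | MT.

Definition bool_of_label (l : label) : bool := if l is TM then true else false.
Definition label_of_bool (b : bool) : label := if b then TM else MT.

Lemma bool_of_labelK : cancel bool_of_label label_of_bool.
Proof. by case. Qed.

HB.instance Definition _ := Finite.copy label (can_type bool_of_labelK).

Definition labelings (N n : nat) : finType :=
  {x : {ffun 'I_N -> label} | (\sum_(j < N) (x j == TM))%N == n}.

Definition loss (N n : nat) (x y : labelings N n) : nat :=
  (\sum_(j < N) (val x j != val y j))%N.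

Section Distributions.
Variables (R : realType) (T : finType).
Implicit Types P Q : {ffun T -> R}.

Definition is_distribution P : Prop :=
  (forall x, 0 <= P x) /\ \sum_x P x = 1.

(* The term at P x = 0 vanishes, as required by the convention 0 log 0 = 0. *)
Definition entropy P : R := - \sum_x P x * ln (P x).

Definition expectation P (Z : T -> R) : R := \sum_x P x * Z x.

Definition cdf_at P (Z : T -> R) (t : R) : R := \sum_(x | Z x <= t) P x.

Definition positive_everywhere P : Prop := forall x, 0 < P x.

Definition dirac_at (y x : T) : R := (x == y)%:R.

Definition uniform_distribution : {ffun T -> R} := [ffun=> #|T|%:R^-1].

End Distributions.

(* Z' with outcomes drawn from P' dominates Z with outcomes drawn from P. *)
Definition fosd (R : realType) (T' T : finType)
    (P' : {ffun T' -> R}) (Z' : T' -> R) (P : {ffun T -> R}) (Z : T -> R) : Prop :=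
  forall t : R, cdf_at P' Z' t <= cdf_at P Z t.

Section Problem.
Variables (R : realType) (N n : nat) (y : labelings N n).

Definition loss_rv (x : labelings N n) : R := (loss x y)%:R.

Definition feasible (h : R) (P : {ffun labelings N n -> R}) : Prop :=
  is_distribution P /\ h <= entropy P.

Definition solution (h : R) (P : {ffun labelings N n -> R}) : Prop :=
  feasible h P /\
  forall Q, feasible h Q -> expectation P loss_rv <= expectation Q loss_rv.

Definition interior_solution (h : R) (P : {ffun labelings N n -> R}) : Prop :=
  solution h P /\ positive_everywhere P.

End Problem.

Definition max_entropy (R : realType) (N n : nat) : R := ln #|labelings N n|%:R.

(* Main.v *)
Require Import Defs.
From mathcomp Require Import all_boot all_order all_algebra.
From mathcomp Require Import all_classical all_reals all_analysis.
From mathcomp Require Import ring lra.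
Import Order.TTheory GRing.Theory Num.Theory.
Import numFieldNormedType.Exports.
Local Open Scope classical_set_scope.
Local Open Scope ring_scope.

(** The candidates are the Gibbs distributions [gibbs L b], with density
    proportional to [expR (- (b * L x))] for an inverse temperature [b >= 0].
    Gibbs' inequality bounds the entropy of any [Q] by
    [b * E_Q[L] + ln (partition_function L b)], with equality iff [Q = gibbs L b].  Hence
    [gibbs L b] is the only minimizer of the expected loss among the
    distributions of at least its entropy, and the entropy is nonincreasing
    in [b].  The entropy is continuous in [b], equals [ln #|T|] at [b = 0] and
    tends to 0 at infinity, so every level [h] is attained.  Since [y] is the
    mode of [gibbs L b], its entropy is at least [- ln (gibbs L b y)], so mass
    at least [expR (- h) >= 1 - h] sits at [y].  Stochastic dominance is the
    monotone likelihood ratio property in [b]. *)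

(** Pointwise Gibbs' inequality: for [q > 0] it is [1 + u <= expR u] at [u = ln (p / q)], strict
    unless [u = 0]. *)
Lemma mul_ln_ratio_leif (R : realType) (p q : R) : 0 < p -> 0 <= q ->
  q * (ln p - ln q) <= p - q ?= iff (q == p).
Proof.
move=> p0; rewrite le_eqVlt => /predU1P[<-|q0].
  by rewrite mul0r subr0 (lt_eqF p0); apply/leifP.
have [->|qp] := eqVneq q p; first by rewrite !subrr mulr0; apply/leifP.
have pq0 : 0 < p / q by rewrite divr_gt0.
have u0 : ln (p / q) != 0.
  rewrite ln_eq0//; apply: contra qp => /eqP pq.
  by rewrite -(divfK (lt0r_neq0 q0) p) pq mul1r.
apply/leifP; rewrite -ln_div ?posrE// -(ltr_pM2l (x := q^-1)) ?invr_gt0//.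
rewrite mulKf ?gt_eqF// mulrBr mulVf ?gt_eqF// ltrBrDl mulrC.
by have := expR_gt1Dx u0; rewrite lnK ?posrE// mulrC.
Qed.

(** Decay bounds used for the entropy at large [b]. The constant 4 comes from squaring
    [1 + u / 2 <= expR (u / 2)]. *)
Lemma expRN_le (R : realType) (u : R) : 0 < u ->
  u * expR (- u) <= 4 / u /\ expR (- u) <= u^-1.
Proof.
move=> u0; have e0 := expR_gt0 u.
rewrite expRN ler_pdivrMr// mulrAC ler_pdivlMr// lef_pV2 ?posrE//.
have h2 : 1 + u / 2 <= expR (u / 2) by exact: expR_ge1Dx.
have eE : expR u = expR (u / 2) * expR (u / 2) by rewrite -expRD; congr expR; field.
split; first by rewrite eE; nra.
by apply: le_trans (expR_ge1Dx _); rewrite lerDr.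
Qed.

(** * Gibbs distributions on a finite type *)

Section Gibbs.
Variables (R : realType) (T : finType) (L : T -> R).
Implicit Types (b : R) (Q : {ffun T -> R}).

Definition partition_function b : R := \sum_x expR (- (b * L x)).

Definition gibbs b : {ffun T -> R} :=
  [ffun x => expR (- (b * L x)) / partition_function b].

Lemma gibbs0 : gibbs 0 = uniform_distribution R T.
Proof.
apply/ffunP => x; rewrite !ffunE /partition_function mul0r oppr0 expR0 mul1r.
by under eq_bigr do rewrite mul0r oppr0 expR0; rewrite sumr_const.
Qed.

Lemma ln_partition_function0 : ln (partition_function 0) = ln #|T|%:R.
Proof.
by rewrite /partition_function; under eq_bigr do rewrite mul0r oppr0 expR0;
  rewrite sumr_const.
Qed.

Lemma continuous_partition_function : continuous partition_function.
Proof.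
apply: continuous_big => [|x _ b]; first exact: add_continuous.
apply: (continuous_comp (f := fun b => - (b * L x)) (g := expR)).
  by apply: cvgN; apply: cvgM; [exact: cvg_id|exact: cvg_cst].
exact: continuous_expR.
Qed.

Hypothesis T0 : (0 < #|T|)%N.

Lemma partition_function_gt0 b : 0 < partition_function b.
Proof.
have [x _] := card_gt0P T0.
rewrite /partition_function (bigD1 x)//= ltr_pwDl ?expR_gt0// sumr_ge0// => z _.
Qed.

Lemma gibbs_gt0 b : positive_everywhere (gibbs b).
Proof. by move=> x; rewrite ffunE divr_gt0 ?expR_gt0 ?partition_function_gt0. Qed.

Lemma gibbs_distribution b : is_distribution (gibbs b).
Proof.
split=> [x|]; first exact/ltW/gibbs_gt0.
under eq_bigr do rewrite ffunE.
by rewrite -mulr_suml divff// gt_eqF// partition_function_gt0.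
Qed.

Lemma ln_gibbs b x : ln (gibbs b x) = - (b * L x) - ln (partition_function b).
Proof.
by rewrite ffunE ln_div ?posrE ?expR_gt0 ?partition_function_gt0// expRK.
Qed.

(** Sum the pointwise inequality at [p = gibbs b x], [q = Q x]: both masses are 1, and
    [ln (gibbs b x)] is affine in [L x]. *)
Lemma entropy_leif_gibbs b Q : is_distribution Q ->
  entropy Q <= b * Defs.expectation Q L + ln (partition_function b)
    ?= iff (Q == gibbs b).
Proof.
move=> [Q0 Q1].
have := leif_sum (P := predT)
  (fun x _ => mul_ln_ratio_leif _ _ _ (gibbs_gt0 b x) (Q0 x)).
rewrite sumrB (gibbs_distribution b).2 Q1 subrr.
have -> : \sum_x Q x * (ln (gibbs b x) - ln (Q x)) =
    entropy Q - (b * Defs.expectation Q L + ln (partition_function b)).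
  transitivity (\sum_x (- (Q x * ln (Q x)) - (b * (Q x * L x) +
      Q x * ln (partition_function b)))).
    by apply: eq_bigr => x _; rewrite ln_gibbs; ring.
  by rewrite sumrB sumrN big_split /= -mulr_sumr -mulr_suml Q1 mul1r.
rewrite /Order.leif subr_le0 subr_eq0 => -[-> ->]; split=> //.
apply/forallP/eqP => [QE|-> x]; last by rewrite /= eqxx.
apply/ffunP => x.
by apply/eqP; exact: QE.
Qed.

Lemma entropy_gibbs b :
  entropy (gibbs b) = b * Defs.expectation (gibbs b) L + ln (partition_function b).
Proof.
by apply/eqP; rewrite (entropy_leif_gibbs b _ (gibbs_distribution b)).
Qed.

(** Strictness in Gibbs' inequality gives a strict inequality between the expectations multiplied by
    [b]; this excludes [b = 0], so [b] cancels. *)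
Lemma expectation_gibbs_lt b Q : 0 <= b -> is_distribution Q ->
  entropy (gibbs b) <= entropy Q -> Q != gibbs b ->
  0 < b /\ Defs.expectation (gibbs b) L < Defs.expectation Q L.
Proof.
move=> b0 dQ HQ QP.
have := lt_leif (entropy_leif_gibbs b _ dQ); rewrite QP => /(le_lt_trans HQ).
rewrite entropy_gibbs ltrD2r => lt_bE.
have b_gt0 : 0 < b.
  by rewrite lt_neqAle b0 andbT; apply: contraTneq lt_bE => <-; rewrite !mul0r ltxx.
by split=> //; rewrite -(ltr_pM2l b_gt0).
Qed.

(** Adding Gibbs' inequality in both directions gives [(b' - b) * (E' - E) <= 0], so [E' <= E]; the
    first direction then compares the entropies. *)
Lemma entropy_gibbs_nonincreasing b b' : 0 <= b -> b <= b' ->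
  entropy (gibbs b') <= entropy (gibbs b).
Proof.
move=> b0; rewrite le_eqVlt => /predU1P[->//|bb'].
have le1 := (entropy_leif_gibbs b _ (gibbs_distribution b')).1.
have le2 := (entropy_leif_gibbs b' _ (gibbs_distribution b)).1.
move: le1 le2; rewrite !entropy_gibbs.
set E := Defs.expectation (gibbs b) L; set E' := Defs.expectation (gibbs b') L.
move=> le1 le2.
have EE' : E' <= E.
  rewrite -(ler_pM2l (x := b' - b)) ?subr_gt0// !mulrBl; lra.
apply: le_trans le1 _; rewrite lerD2r; exact: ler_wpM2l.
Qed.

Lemma continuous_entropy_gibbs : continuous (fun b => entropy (gibbs b)).
Proof.
(* With the log density expanded, the only logarithm left is at the positive partition function. *)
have -> : (fun b => entropy (gibbs b)) =
    (fun b => - \sum_x gibbs b x * (- (b * L x) - ln (partition_function b))).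
  by apply/funext => b; rewrite /entropy; under eq_bigr do rewrite ln_gibbs.
have cvL x b : - (c * L x) @[c --> b] --> - (b * L x).
  by apply: cvgN; apply: cvgM; [exact: cvg_id|exact: cvg_cst].
have cvlnZ b : ln (partition_function c) @[c --> b] --> ln (partition_function b).
  have := continuous_ln (partition_function_gt0 b).
  exact: (cvg_comp _ _ (continuous_partition_function b)).
move=> b; apply: cvgN; move: b.
apply: continuous_big => [|x _ b]; first exact: add_continuous.
apply: cvgM.
  rewrite ffunE; under eq_fun do rewrite ffunE; apply: cvgM.
    exact: (cvg_comp _ _ (cvL x b) (@continuous_expR R _)).
  by apply: cvgV; [rewrite gt_eqF// partition_function_gt0|
    exact: continuous_partition_function].
by apply: cvgB; [exact: cvL|exact: cvlnZ].
Qed.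

(* Monotone likelihood ratio: after clearing denominators and cancelling the
   common terms, the inequality holds pairwise for [x] below and [z] above the
   threshold [t]. *)
Lemma fosd_gibbs b b' : b' <= b -> fosd (gibbs b') L (gibbs b) L.
Proof.
move=> bb' t; rewrite /cdf_at.
under eq_bigr do rewrite ffunE; under [leRHS]eq_bigr do rewrite ffunE.
rewrite -!mulr_suml ler_pdivrMr ?partition_function_gt0// mulrAC.
rewrite ler_pdivlMr ?partition_function_gt0//.
rewrite /partition_function [X in _ * X <= _](bigID (fun x => L x <= t)).
rewrite [X in _ <= _ * X](bigID (fun x => L x <= t))/= !mulrDr.
rewrite [X in _ <= X + _]mulrC lerD2l !mulr_suml ler_sum// => x xt.
rewrite !mulr_sumr ler_sum// => z; rewrite -ltNge => tz.
rewrite -!expRD ler_expR.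
have : 0 <= (b - b') * (L z - L x).
  by rewrite mulr_ge0 ?subr_ge0// (le_trans xt)// ltW.
rewrite mulrBl !mulrBr.
lra.
Qed.

(** * Concentration at the unique zero [y] of the loss, and the attained entropies *)

Section Mode.
Variable y : T.
Hypotheses (Ly : L y = 0) (L_ge1 : forall x, x != y -> 1 <= L x).

Lemma entropy_gibbs_ge b : 0 <= b -> - ln (gibbs b y) <= entropy (gibbs b).
Proof.
move=> b0; rewrite /entropy lerN2.
have <- : \sum_x gibbs b x * ln (gibbs b y) = ln (gibbs b y).
  by rewrite -mulr_suml (gibbs_distribution b).2 mul1r.
apply: ler_sum => x _; rewrite ler_wpM2l//; first exact/ltW/gibbs_gt0.
rewrite !ln_gibbs lerD2r lerN2 Ly mulr0 mulr_ge0//.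
by have [->|/L_ge1/(le_trans ler01)//] := eqVneq x y; rewrite Ly.
Qed.

(** The mass missing at [y] is at most the entropy, and every other point carries at most that
    missing mass. *)
Lemma gibbs_dirac_dist b x : 0 <= b ->
  `|gibbs b x - dirac_at R y x| <= entropy (gibbs b).
Proof.
move=> b0; have g0 z := gibbs_gt0 b z; have [_ g1] := gibbs_distribution b.
rewrite (bigD1 y)//= in g1.
have gy : 1 - entropy (gibbs b) <= gibbs b y.
  rewrite -(lnK (x := gibbs b y)) ?posrE//; apply: le_trans (expR_ge1Dx _).
  by have := entropy_gibbs_ge b b0; lra.
have sum0 : 0 <= \sum_(i | i != y) gibbs b i by apply: sumr_ge0 => z _; exact/ltW.
rewrite /dirac_at; have [->|xy] := eqVneq x y.
  rewrite mulr1n ler0_norm; lra.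
rewrite mulr0n subr0 gtr0_norm//.
have : gibbs b x <= \sum_(i | i != y) gibbs b i.
  by rewrite (bigD1 x)//= lerDl sumr_ge0// => z _; exact/ltW.
lra.
Qed.

(** With [u = b * L x >= b], each [x != y] contributes at most [u * expR (- u) + expR (- u) <= 4 / u
    + 1 / u <= 5 / b]. *)
Lemma entropy_gibbs_le b : 0 < b -> entropy (gibbs b) <= 5 * #|T|%:R / b.
Proof.
move=> b0; rewrite entropy_gibbs.
have Z1 : partition_function b = 1 + \sum_(x | x != y) expR (- (b * L x)).
  by rewrite /partition_function (bigD1 y)//= Ly mulr0 oppr0 expR0.
have S0 : 0 <= \sum_(x | x != y) expR (- (b * L x)).
  by apply: sumr_ge0 => x _; exact: expR_ge0.
have bE : b * Defs.expectation (gibbs b) L <=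
    \sum_(x | x != y) b * L x * expR (- (b * L x)).
  rewrite /Defs.expectation (bigD1 y)//= Ly mulr0 add0r mulr_sumr ler_sum// => x xy.
  have Lx := L_ge1 x xy.
  rewrite mulrCA mulrC ler_wpM2l ?mulr_ge0//; try lra.
  rewrite ffunE ler_pdivrMr ?partition_function_gt0// ler_peMr ?expR_ge0//.
  by rewrite Z1 lerDl.
have lnZ : ln (partition_function b) <= \sum_(x | x != y) expR (- (b * L x)).
  by rewrite Z1 le_ln1Dx// (lt_le_trans _ S0)// ltrN10.
apply: le_trans (lerD bE lnZ) _; rewrite -big_split /=.
have -> : 5 * #|T|%:R / b = \sum_(x : T) 5 / b.
  by rewrite sumr_const -mulr_natr; ring.
rewrite big_mkcond ler_sum//= => x _.
case: ifPn => [xy|_]; last by rewrite divr_ge0// ltW.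
have Lx := L_ge1 x xy; have bLx : b <= b * L x by rewrite ler_peMr// ltW.
have u0 : 0 < b * L x by exact: lt_le_trans bLx.
have [le4 le1] := expRN_le _ _ u0.
have inv : (b * L x)^-1 <= b^-1 by rewrite lef_pV2.
lra.
Qed.

Lemma entropy_gibbs_surj h : 0 < h <= ln #|T|%:R ->
  exists2 b, 0 <= b & entropy (gibbs b) = h.
Proof.
case/andP=> h0 hT; have T0' : 0 < #|T|%:R :> R by rewrite ltr0n.
(* At this [b] the bound of [entropy_gibbs_le] is exactly [h]. *)
have B0 : 0 < 5 * #|T|%:R / h by rewrite divr_gt0// mulr_gt0.
have HB : entropy (gibbs (5 * #|T|%:R / h)) <= h.
  have := entropy_gibbs_le _ B0.
  by rewrite invf_div mulrCA divff ?mulr1// mulf_neq0// ?gt_eqF.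
have H0 : entropy (gibbs 0) = ln #|T|%:R.
  by rewrite entropy_gibbs mul0r add0r ln_partition_function0.
have [|b] := IVT (f := fun b => entropy (gibbs b)) (v := h) (ltW B0)
    (continuous_subspaceT continuous_entropy_gibbs).
  by rewrite H0 ge_min le_max HB hT orbT.
by rewrite in_itv/= => /andP[b0 _] bh; exists b.
Qed.

End Mode.
End Gibbs.

Arguments gibbs {R T} L b.

(** * Application to the misclassification loss *)

Lemma loss_eq0 N n (x y : labelings N n) : (loss x y == 0)%N = (x == y).
Proof.
rewrite /loss sum_nat_eq0; apply/forallP/eqP => [xy|-> j]; last by rewrite eqxx.
by apply/val_inj/ffunP => j; have := xy j; rewrite /= eqb0 negbK => /eqP.
Qed.

Theorem theorem1 (R : realType) (N n : nat) (hN : (1 <= N)%N) (hn : (n <= N)%N)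
    (y : labelings N n) :
  let hbar := max_entropy R N n in
  exists Pstar : R -> {ffun labelings N n -> R},
    (forall h : R, 0 < h <= hbar ->
       unique (interior_solution y h) (Pstar h)) /\
    (forall h : R, 0 < h <= hbar -> entropy (Pstar h) = h) /\
    (0 < hbar ->
       sup (range (fun x => `|Pstar h x - dirac_at R y x|)) @[h --> 0^'+] --> (0 : R)) /\
    (0 < hbar -> Pstar hbar = uniform_distribution R (labelings N n)) /\
    (forall h h' : R, 0 < h <= hbar -> 0 < h' <= hbar -> h <= h' ->
       fosd (Pstar h') (loss_rv R y) (Pstar h) (loss_rv R y)).
Proof.
move=> hbar.
have T0 : (0 < #|labelings N n|)%N by apply/card_gt0P; exists y.
have Ly : loss_rv R y y = 0.
  by apply/eqP; rewrite pnatr_eq0 loss_eq0.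
have L_ge1 x : x != y -> 1 <= loss_rv R y x.
  by rewrite -loss_eq0 -lt0n => xy; rewrite ler1n.
(* The range condition sits under the existential so that choice yields a total [beta], with
   arbitrary value 0 outside the range. *)
have ex_b h : exists b, 0 < h <= hbar ->
    0 <= b /\ entropy (gibbs (loss_rv R y) b) = h.
  have [hP|] := pselect (is_true (0 < h <= hbar)); last by exists 0.
  by have [b b0 bh] := entropy_gibbs_surj _ _ _ T0 _ Ly L_ge1 _ hP; exists b.
have {ex_b}[beta betaP] := choice ex_b.
exists (fun h => gibbs (loss_rv R y) (beta h)); split; [|split; [|split; [|split]]].
- move=> h hP; have [b0 bh] := betaP h hP.
  have lt_P Q : feasible h Q -> Q != gibbs (loss_rv R y) (beta h) ->
      Defs.expectation (gibbs (loss_rv R y) (beta h)) (loss_rv R y) <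
      Defs.expectation Q (loss_rv R y).
    move=> [dQ]; rewrite -{1}bh => hQ QP.
    by have [] := expectation_gibbs_lt _ _ _ T0 _ _ b0 dQ hQ QP.
  have fP : feasible h (gibbs (loss_rv R y) (beta h)).
    by split; [exact: gibbs_distribution|rewrite bh].
  split.
    split; last exact: gibbs_gt0.
    split=> // Q fQ.
    by have [->|/(lt_P Q fQ)/ltW] := eqVneq Q (gibbs (loss_rv R y) (beta h)).
  move=> Q [[fQ minQ] _]; apply/esym/eqP/contraT => /(lt_P Q fQ).
  by rewrite ltNge minQ.
- by move=> h /betaP[].
(* The supremum lies between 0 and the entropy, which is [h]. *)
- move=> hbar0; apply: (squeeze_cvgr (f := fun=> 0) (h := id)).
  + near=> h.
    have hP : 0 < h <= hbar.
      by apply/andP; split; near: h; [exact: nbhs_right_gt|exact: nbhs_right_le].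
    have [b0 bh] := betaP h hP.
    have dist_le x := gibbs_dirac_dist _ _ _ T0 _ Ly L_ge1 _ x b0.
    apply/andP; split.
      apply: le_trans (normr_ge0 (gibbs (loss_rv R y) (beta h) y - dirac_at R y y)) _.
      apply: ub_le_sup; last by exists y.
      by exists (entropy (gibbs (loss_rv R y) (beta h))) => _ [x _ <-].
    apply: ge_sup; first by eexists; exists y.
    by move=> _ [x _ <-]; rewrite -[leRHS]bh.
  + exact: cvg_cst.
  + exact: cvg_at_right_filter.
(* Entropy [hbar] is the equality case of Gibbs' inequality at parameter 0, whose Gibbs distribution
   is uniform. *)
- move=> hbar0; have [_ bh] := betaP hbar (introT andP (conj hbar0 (lexx _))).
  have dP := gibbs_distribution _ _ (loss_rv R y) T0 (beta hbar).
  have := (entropy_leif_gibbs _ _ (loss_rv R y) T0 0 _ dP).2.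
  by rewrite bh mul0r add0r ln_partition_function0 eqxx gibbs0 => /esym/eqP.
- move=> h h' /betaP[b0 bh] /betaP[b0' bh'] hh'.
  (* If [beta] increases from [h] to [h'], monotonicity of the entropy forces [h = h'], and
     dominance is reflexive. *)
  have [bb'|/ltW bb'] := leP (beta h') (beta h); first exact: fosd_gibbs.
  have := entropy_gibbs_nonincreasing _ _ (loss_rv R y) T0 _ _ b0 bb'.
  rewrite bh bh' => h'h.
  have -> : h = h' by apply/le_anti/andP.
  by move=> t.
Unshelve. all: by end_near.
Qed.
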